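(* Let $X,Y$ be Banach spaces, $n\ge1$, and let $F:X\times\mathbb R^n\to Y$ satisfy assumptions (B1)–(B6) listed in the context. Let $\varepsilon>0$ and let $(x(\cdot),\boldsymbol c(\cdot))\in C^{k-1}(B_\varepsilon(0;\mathbb R^n),X\times\mathbb R^n)$ be the family of solutions of $F(x(\boldsymbol s),\boldsymbol c(\boldsymbol s))=0$ with $$x(\boldsymbol s)=\sum_{i=1}^ns_ix_i+\tilde x(\boldsymbol s),\quad\tilde x(\boldsymbol s)\in\tilde X,\quad \tilde x(\boldsymbol s)=o(|\boldsymbol s|),\qquad\boldsymbol c(\boldsymbol s)=\boldsymbol c^*+O(|\boldsymbol s|),$$ given by local bifurcation theory. Define $G(\tilde x,\boldsymbol c,\boldsymbol s)=F\big(\sum_{i=1}^ns_ix_i+\tilde x,\boldsymbol c\big)$ for $\tilde x\in\tilde X$, and the linear operator $$A(\boldsymbol s):\tilde X\times\mathbb R^n\to Y,\qquad(\tilde v,b)\mapsto G_{\tilde x}(\tilde x(\boldsymbol s),\boldsymbol c(\boldsymbol s),\boldsymbol s)\tilde v+G_{\boldsymbol c}(\tilde x(\boldsymbol s),\boldsymbol c(\boldsymbol s),\boldsymbol s)b.$$ Fix $\hat{\boldsymbol s}\in S^{n-1}$ with $\hat s_i\neq0$ for all $i=1,\dots,n$. Then there is $r_0>0$ such that $A(r\hat{\boldsymbol s})$ is an isomorphism for all $0<r<r_0$.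
   Context: Assumptions: (B1) $F$ is $C^k$ with $k\ge2$, $k=\infty$, or $k=\omega$ (analytic); $F(0,\boldsymbol c)=0$ for all $\boldsymbol c\in\mathbb R^n$; and there is $\boldsymbol c^*\in\mathbb R^n$ such that $L:=D_1F[0,\boldsymbol c^*]:X\to Y$ is Fredholm of index $0$. (For $k=\infty,\omega$, read $C^{k-1}$ as $C^k$.) (B2) $\ker L=\operatorname{span}\{x_1,\dots,x_n\}$ is $n$-dimensional. (B3) $X=\big(\bigoplus_{i=1}^nX_i\big)\oplus\tilde X$ and $Y=\big(\bigoplus_{i=1}^nY_i\big)\oplus\tilde Y$ (closed subspaces), with $X_i=\operatorname{span}\{x_i\}$, $Y_i=\operatorname{span}\{y_i\}$ and $\tilde Y=\operatorname{ran}L$. (B4) $Q_i$ and $P_i$ are the projections onto $X_i$ and $Y_i$ along $\widehat X_i\oplus\tilde X$ and $\widehat Y_i\oplus\tilde Y$, respectively, where $\widehat X_i=\bigoplus_{j\ne i}X_j$ and $\widehat Y_i=\bigoplus_{j\neq i}Y_j$. (B5) The matrix $(\nu_{ij})$ determined by $P_iD_1D_{j+1}F[0,\boldsymbol c^*](x_i,c_j-c_j^* )=\nu_{ij}(c_j-c_j^* )y_i$ is invertible, where $D_1$ is the derivative in $x\in X$ and $D_{j+1}$ the derivative in $c_j$. (B6) For each $i=1,\dots,n$ there exist closed subspaces $\tilde X_i\subset\tilde X$ and $\tilde Y_i\subset\tilde Y$ such that $F(\widehat X_i\oplus\tilde X_i,\boldsymbol c)\subseteq\widehat Y_i\oplus\tilde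 Y_i$ for all $\boldsymbol c$, and $(I-P_i)D_1F[0,\boldsymbol c^*]|_{\widehat X_i\oplus\tilde X_i}:\widehat X_i\oplus\tilde X_i\to\widehat Y_i\oplus\tilde Y_i$ is Fredholm of index $0$ with kernel $\widehat X_i$. (Under these assumptions a local solution family as in the claim exists by multi-parameter local bifurcation theory.) *)

(* Defs.v *)
From HB Require Import structures.
From mathcomp Require Import all_boot all_order all_algebra.
From mathcomp Require Import all_classical all_reals all_analysis.

Set Implicit Arguments.
Unset Strict Implicit.
Unset Printing Implicit Defensive.

Import Order.TTheory GRing.Theory Num.Theory.
Import numFieldNormedType.Exports.

Local Open Scope classical_set_scope.
Local Open Scope ring_scope.

(* The proofs in this file only equip subspaces and spaces of bounded linear
   maps with their norms. *)

(* A linear subspace as a normed space, with the norm of the ambient space. *)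
Section Subspace.
Context {R : realType} {E : normedModType R} (S : submodClosed E).

Definition subsp : Type := {v : E | v \in S}.

HB.instance Definition _ := SubType.on subsp.
HB.instance Definition _ := [Choice of subsp by <:].
HB.instance Definition _ := [SubChoice_isSubLmodule of subsp by <:].

Let nm (v : subsp) : R := `|val v|.

Let nmD u v : nm (u + v) <= nm u + nm v.
Proof. by rewrite /nm raddfD ler_normD. Qed.

Let nmZ l v : nm (l *: v) = `|l| * nm v.
Proof. by rewrite /nm linearZ normrZ. Qed.

Let nm0 v : nm v = 0 -> v = 0.
Proof. by move=> /normr0_eq0 v0; apply: val_inj; rewrite v0 raddf0. Qed.

HB.instance Definition _ := @Lmodule_isNormed.Build R subsp nm nmD nmZ nm0.

End Subspace.

Section SubspaceOperations.
Context {R : realType} {E : normedModType R}.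

Definition line (v : E) : {pred E} := [pred u | `[< exists a : R, u = a *: v >]].

Lemma line_submod v : submod_closed (line v).
Proof.
split; first by apply/asboolP; exists 0; rewrite scale0r.
move=> a u w /asboolP[b ->] /asboolP[d ->]; apply/asboolP.
by exists (a * b + d); rewrite scalerDl scalerA.
Qed.

HB.instance Definition _ v := GRing.isSubmodClosed.Build R E (line v)
  (line_submod v).

Definition addsp (U V : submodClosed E) : {pred E} :=
  [pred w | `[< exists u v, [/\ u \in U, v \in V & w = u + v] >]].

Lemma addsp_submod U V : submod_closed (addsp U V).
Proof.
split; first by apply/asboolP; exists 0, 0; rewrite !rpred0 addr0.
move=> a _ _ /asboolP[u [v [uU vV ->]]] /asboolP[u' [v' [u'U v'V ->]]].
apply/asboolP; exists (a *: u + u'), (a *: v + v').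
by rewrite !rpredD ?rpredZ// scalerDr addrACA.
Qed.

HB.instance Definition _ U V := GRing.isSubmodClosed.Build R E (addsp U V)
  (addsp_submod U V).

Definition sumsp (I : finType) (A : {pred I}) (V : I -> submodClosed E) :
    {pred E} :=
  [pred w | `[< exists v : I -> E,
    (forall i, i \in A -> v i \in V i) /\ w = \sum_(i in A) v i >]].

Lemma sumsp_submod (I : finType) (A : {pred I}) V : submod_closed (sumsp A V).
Proof.
split.
  apply/asboolP; exists (fun=> 0); rewrite big1//.
  by split=> // i _; exact: rpred0.
move=> a _ _ /asboolP[v [vV ->]] /asboolP[w [wV ->]]; apply/asboolP.
exists (fun i => a *: v i + w i); split.
  by move=> i iA; rewrite rpredD ?rpredZ ?vV ?wV.
by rewrite scaler_sumr -big_split.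
Qed.

HB.instance Definition _ (I : finType) (A : {pred I}) V :=
  GRing.isSubmodClosed.Build R E (sumsp A V) (sumsp_submod A V).

(* E = (\bigoplus_i V i) \oplus W *)
Definition direct_decomposition (I : finType) (V : I -> submodClosed E)
    (W : submodClosed E) : Prop :=
  (forall e : E, exists (v : I -> E) (w : E),
     [/\ forall i, v i \in V i, w \in W & e = \sum_i v i + w]) /\
  (forall (v : I -> E) (w : E), (forall i, v i \in V i) -> w \in W ->
     \sum_i v i + w = 0 -> (forall i, v i = 0) /\ w = 0).

(* Meaningful when E = U \oplus V. *)
Definition projection_onto_along (P : {linear E -> E}) (U V : submodClosed E) :
    Prop :=
  forall u v, u \in U -> v \in V -> P (u + v) = u.

Definition has_dim (d : nat) (S : set E) : Prop :=
  exists b : 'I_d -> E,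
    (forall a : 'I_d -> R, \sum_i a i *: b i = 0 -> forall i, a i = 0) /\
    S = [set v | exists a : 'I_d -> R, v = \sum_i a i *: b i].

(* The classes of b 0, ..., b (d-1) form a basis of the quotient E / S. *)
Definition has_codim (d : nat) (S : set E) : Prop :=
  exists b : 'I_d -> E,
    (forall a : 'I_d -> R, S (\sum_i a i *: b i) -> forall i, a i = 0) /\
    (forall v, exists a : 'I_d -> R, S (v - \sum_i a i *: b i)).

End SubspaceOperations.

Section Operators.
Context {R : realType} {E F : normedModType R}.

Definition kernel_of (T : E -> F) : set E := [set u | T u = 0].

Definition fredholm_of_index (m : int) (T : {linear E -> F}) : Prop :=
  [/\ continuous T, closed (range T) &
      exists p q : nat, [/\ has_dim p (kernel_of T), has_codim q (range T) &
        m = p%:Z - q%:Z]].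

Definition isomorphism (T : E -> F) : Prop :=
  [/\ linear T, continuous T &
      exists S : F -> E, [/\ continuous S, cancel T S & cancel S T]].

End Operators.

(* The space of bounded linear maps with the operator norm. *)
Section BoundedLinear.
Context {R : realType} (E F : normedModType R).

Definition blin_pred : {pred (E -> F)} :=
  [pred f : E -> F | `[< linear f /\ continuous f >]].

Lemma blin_submod : submod_closed blin_pred.
Proof.
split.
  by apply/asboolP; split=> [a u v|x]; rewrite ?scaler0 ?addr0//; exact: cvg_cst.
move=> a f g /asboolP[lf cf] /asboolP[lg cg]; apply/asboolP; split.
  move=> b u v; rewrite !fctE lf lg !scalerDr !scalerA addrACA.
  by rewrite [a * b]mulrC.
by move=> x; apply: cvgD; [apply: cvgZl_tmp; exact: cf|exact: cg].
Qed.

HB.instance Definition _ := GRing.isSubmodClosed.Build R (E -> F) blin_pred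
  blin_submod.

Definition blin : Type := {f : E -> F | f \in blin_pred}.

HB.instance Definition _ := SubType.on blin.
HB.instance Definition _ := [Choice of blin by <:].
HB.instance Definition _ := [SubChoice_isSubLmodule of blin by <:].

Definition blin_fun (f : blin) : E -> F := val f.
Coercion blin_fun : blin >-> Funclass.

Lemma blin_linear (f : blin) : linear f.
Proof. by have /asboolP[] := valP f. Qed.

HB.instance Definition _ (f : blin) :=
  GRing.isLinear.Build R E F _ (blin_fun f) (blin_linear f).

Lemma blin_continuous (f : blin) : continuous f.
Proof. by have /asboolP[] := valP f. Qed.

Definition opnorm (f : blin) : R := sup [set `|f x| | x in [set x | `|x| <= 1]].

Lemma opnorm_has_sup (f : blin) :
  has_sup [set `|f x| | x in [set x | `|x| <= 1]].
Proof.
split; first by exists `|f 0|, 0 => //=; rewrite normr0.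
have /linear_boundedP[M [Mr fM]] :=
  @continuous_linear_bounded _ _ _ 0 f (blin_continuous (x:=0)).
exists `|M + 1| => _ [x /= x1 <-].
apply: le_trans (fM (M + 1) _ x) _; first by rewrite ltrDl.
rewrite (le_trans (ler_norm _))// normrM normr_id ler_piMr//.
Qed.

Lemma opnorm_ball (f : blin) x : `|x| <= 1 -> `|f x| <= opnorm f.
Proof.
by move=> x1; apply: ub_le_sup; [have [] := opnorm_has_sup f|exists x].
Qed.

Lemma opnorm_ub (f : blin) x : `|f x| <= opnorm f * `|x|.
Proof.
have [->|x0] := eqVneq x 0; first by rewrite linear0 !normr0 mulr0.
have nx0 : 0 < `|x| by rewrite normr_gt0.
rewrite -ler_pdivrMr//.
have -> : `|f x| / `|x| = `|f (`|x|^-1 *: x)|.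
  by rewrite linearZ normrZ normfV normr_id mulrC.
apply: opnorm_ball.
by rewrite normrZ normfV normr_id mulVf// gt_eqF.
Qed.

Lemma opnormD (f g : blin) : opnorm (f + g) <= opnorm f + opnorm g.
Proof.
apply: ge_sup; first by have [] := opnorm_has_sup (f + g).
move=> _ [x /= x1 <-]; rewrite [X in `|X|](_ : _ = f x + g x)//.
apply: le_trans (ler_normD _ _) _.
by apply: lerD; exact: opnorm_ball.
Qed.

Lemma opnorm_ge0 (f : blin) : 0 <= opnorm f.
Proof.
by apply: le_trans (normr_ge0 (f 0)) _; apply: opnorm_ball; rewrite normr0.
Qed.

Lemma opnormZ_le l (f : blin) : opnorm (l *: f) <= `|l| * opnorm f.
Proof.
apply: ge_sup; first by have [] := opnorm_has_sup (l *: f).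
move=> _ [x /= x1 <-]; rewrite [X in `|X|](_ : _ = l *: f x)// normrZ.
by rewrite ler_wpM2l// opnorm_ball.
Qed.

Lemma opnormZ l (f : blin) : opnorm (l *: f) = `|l| * opnorm f.
Proof.
apply/eqP; rewrite eq_le opnormZ_le/=.
have [->|l0] := eqVneq l 0; first by rewrite normr0 mul0r opnorm_ge0.
rewrite -ler_pdivlMl ?normr_gt0// -normfV.
rewrite -{1}[f](scalerK l0); exact: opnormZ_le.
Qed.

Lemma opnorm0_eq0 (f : blin) : opnorm f = 0 -> f = 0.
Proof.
move=> f0; apply: val_inj; apply/funext => x; apply/eqP.
by rewrite -normr_le0; have := opnorm_ub f x; rewrite f0 mul0r.
Qed.

HB.instance Definition _ :=
  @Lmodule_isNormed.Build R blin opnorm opnormD opnormZ opnorm0_eq0.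

End BoundedLinear.

Section Smoothness.
Context {R : realType} {E : normedModType R}.

(* C^k on an open set U: the Fréchet derivative, as a map into the space of
   bounded linear maps, is C^(k-1) on U. *)
Fixpoint Ck_on (k : nat) (F : normedModType R) (U : set E) (f : E -> F) :
    Prop :=
  if k is k'.+1 then
    exists2 Df : E -> blin E F, (forall x, U x -> is_diff x f (Df x)) &
      @Ck_on k' (blin E F) U Df
  else forall x, U x -> {for x, continuous f}.

(* Bounded j-linear maps E x ... x E -> F, in curried form, so that the norm is
   the usual norm of multilinear maps. *)
Fixpoint mlin (F : normedModType R) (j : nat) : normedModType R :=
  if j is j'.+1 then blin E (mlin F j') else F.

Fixpoint mlin_diag (F : normedModType R) (j : nat) (h : E) : mlin F j -> F :=
  match j return mlin F j -> F with
  | 0 => fun a => a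
  | j'.+1 => fun a => mlin_diag h ((a : blin E (mlin F j')) h)
  end.

(* The a j need not be symmetric: symmetrizing them changes neither the series
   nor the geometric bound on the norms. *)
Definition power_series_at (F : normedModType R) (f : E -> F) (x : E) : Prop :=
  exists a : forall j, mlin F j,
    (exists C M : R, forall j, `|a j| <= C * M ^+ j) /\
    \forall h \near (0 : E),
      series (fun j => mlin_diag h (a j)) @ \oo --> f (x + h).

Inductive smoothness : Type := Cfin of nat | Cinfty | Comega.

(* The inclusion of C^omega in C^infty is built into the definition. *)
Definition smooth_on (k : smoothness) (F : normedModType R) (U : set E)
    (f : E -> F) : Prop :=
  match k with
  | Cfin m => Ck_on m U f
  | Cinfty => forall m, Ck_on m U f
  | Comega => (forall m, Ck_on m U f) /\ forall x, U x -> power_series_at f x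
  end.

End Smoothness.

Definition at_least_C2 (k : smoothness) : bool :=
  if k is Cfin m then (2 <= m)%N else true.

Definition pred_smoothness (k : smoothness) : smoothness :=
  if k is Cfin m then Cfin m.-1 else k.

Section Problem.
Context {R : realType} {X Y : normedModType R} {n : nat}.
Implicit Types (F : X * 'rV[R]_n -> Y) (c s : 'rV[R]_n).

(* The library norm on 'rV[R]_n is the sup norm. *)
Definition enorm s : R := Num.sqrt (\sum_i s 0 i ^+ 2).

Definition D1 F (x : X) c : {linear X -> Y} := 'd (fun x' => F (x', c)) x.

Definition set_coord c (j : 'I_n) (t : R) : 'rV[R]_n :=
  \row_l (if l == j then t else c 0 l).

Definition Dc F (j : 'I_n) (x : X) c : {linear R^o -> Y} :=
  'd (fun t : R^o => F (x, set_coord c j t)) (c 0 j : R^o).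

(* (D_1 D_{c_j} F)[x, c](v, t): the derivative at x in direction v of the map
   x' |-> D_{c_j} F[x', c] t. *)
Definition D1Dc F (j : 'I_n) (x : X) c (v : X) (t : R) : Y :=
  'd (fun x' => Dc F j x' c t) x v.

Variables (F : X * 'rV[R]_n -> Y) (x_ : 'I_n -> X) (Xt : submodClosed X).

Definition G (xt : subsp Xt) c s : Y :=
  F (\sum_i s 0 i *: x_ i + val xt, c).

Definition A (xt : 'rV[R]_n -> subsp Xt) (c : 'rV[R]_n -> 'rV[R]_n) s
    (vb : subsp Xt * 'rV[R]_n) : Y :=
  'd (fun xt' => G xt' (c s) s) (xt s) vb.1 +
  'd (fun c' => G (xt s) c' s) (c s) vb.2.

End Problem.

(* \hat V_i = \bigoplus_{j <> i} span {v_j} *)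
Notation hatsp v i := (sumsp (predC1 i) (fun j => line (v j))).

(* Main.v *)
Require Import Defs.
From HB Require Import structures.
From mathcomp Require Import all_boot all_order all_algebra.
From mathcomp Require Import all_classical all_reals all_analysis.
From mathcomp Require Import ring lra.

Set Implicit Arguments.
Unset Strict Implicit.
Unset Printing Implicit Defensive.

Import Order.TTheory GRing.Theory Num.Theory.
Import numFieldNormedType.Exports.

Local Open Scope classical_set_scope.
Local Open Scope ring_scope.

(* Replace b by b / r in the second variable of A(r shat).  As F(0, c) = 0, the
   partial derivative F_c vanishes along the trivial branch, and a first-order
   expansion of DF at (0, c^* ) shows that the rescaled operators converge in
   norm, as r -> 0+, to
     (v, b) |-> L v + D_1 D_c F[0, c^*](sum_l shat_l x_l, b).
   By (B6), P_i D_1 D_c F[0, c^*](x_l, b) = 0 for l <> i, so applying P_i to this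
   limit leaves shat_i (nu b)_i y_i: the limit is block triangular, with diagonal
   blocks the bijection L : \tilde X -> \tilde Y and the invertible matrix
   diag(shat) nu.  It is therefore an isomorphism, and so are nearby operators. *)

(** * Bounded operators between Banach spaces *)

(** Completeness is a predicate on sequences so that it can be asserted of closed subspaces,
    equipped here only with a norm, and of their products with ['rV[R]_n]. *)
Definition seq_complete (R : realType) (E : normedModType R) : Prop :=
  forall u : E^nat, cauchy (u @ \oo) -> cvg (u @ \oo).

Section SeqComplete.
Context {R : realType}.

Lemma rV_seq_complete n : seq_complete 'rV[R]_n.
Proof. by move=> u /cauchy_cvgP. Qed.

Lemma subsp_seq_complete (E : completeNormedModType R) (S : submodClosed E) :
  closed [set` S] -> seq_complete (subsp S).
Proof.
move=> clS u /cauchy_ballP cu.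
have : cauchy ((fun n => val (u n)) @ \oo).
  apply/cauchy_ballP => e e0; move: (cu e e0).
  rewrite !near_simpl; apply: filterS => -[a b] /=.
  by rewrite -!ball_normE /ball_ /=.
move=> /cauchy_cvgP /cvg_ex[l ul].
have lS : l \in S.
  apply: (@closed_cvg _ _ \oo _ (fun n => val (u n)) [set` S] clS _ l ul).
  by near=> n; exact: valP (u n).
apply/cvg_ex; exists (Sub l lS : subsp S).
apply/cvgrPdist_lt => e e0; move/cvgrPdist_lt : ul => /(_ e e0).
by apply: filterS.
Unshelve. all: by end_near. Qed.

Lemma prod_seq_complete (E F : normedModType R) :
  seq_complete E -> seq_complete F -> seq_complete (E * F)%type.
Proof.
move=> cE cF u /cauchy_ballP cu.
have /cE/cvg_ex[l ul] : cauchy ((fun n => (u n).1) @ \oo).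
  apply/cauchy_ballP => e e0; move: (cu e e0).
  by rewrite !near_simpl; apply: filterS => -[a b] [].
have /cF/cvg_ex[m um] : cauchy ((fun n => (u n).2) @ \oo).
  apply/cauchy_ballP => e e0; move: (cu e e0).
  by rewrite !near_simpl; apply: filterS => -[a b] [].
apply/cvg_ex; exists (l, m).
rewrite [X in X @ _](_ : _ = fun n => ((u n).1, (u n).2)); last first.
  by apply/funext => n; case: (u n).
exact: cvg_pair.
Qed.

End SeqComplete.

Section BoundedOperators.
Context {R : realType} {E F : normedModType R}.

Lemma blin0 (T : blin E F) : T 0 = 0. Proof. exact: linear0. Qed.

Lemma blinD (T : blin E F) u v : T (u + v) = T u + T v.
Proof. exact: linearD. Qed.

Lemma blinB (T : blin E F) u v : T (u - v) = T u - T v.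
Proof. exact: linearB. Qed.

Lemma blinZ (T : blin E F) a u : T (a *: u) = a *: T u.
Proof. exact: linearZ. Qed.

Lemma blin_sum (T : blin E F) (I : finType) (u : I -> E) :
  T (\sum_i u i) = \sum_i T (u i).
Proof. exact: linear_sum. Qed.

Definition Blin (f : E -> F) (lf : linear f) (cf : continuous f) : blin E F :=
  exist _ f (asboolT (conj lf cf)).

Lemma linear_fun_bounded_continuous (f : E -> F) (M : R) :
  linear f -> (forall u, `|f u| <= M * `|u|) -> continuous f.
Proof.
move=> lf fM.
pose g : {linear E -> F} := HB.pack f (GRing.isLinear.Build _ _ _ _ _ lf).
apply: (@bounded_linear_continuous _ _ _ g); apply/linear_boundedP.
near=> r => x; rewrite (le_trans (fM x))// ler_wpM2r//.
Unshelve. all: by end_near. Qed.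

(* The residuals halve at each step, so the successive corrections add up to a solution. *)
Lemma approx_solvable (T : blin E F) (C : R) : seq_complete E ->
  (forall y, exists2 e, `|e| <= C * `|y| & `|y - T e| <= 2^-1 * `|y|) ->
  forall y, exists2 e, T e = y & `|e| <= 2 * C * `|y|.
Proof.
move=> cE /(_ _)/cid2-/all_sig[g gP] y.
(* [r n] is the residual left after [n] corrections, and [S n] is the sum of these corrections. *)
pose r := fix r n := if n is n'.+1 then r n' - T (g (r n')) else y.
pose S := fix S n := if n is n'.+1 then S n' + g (r n') else 0 : E.
have TS n : T (S n) = y - r n.
  elim: n => [|n IH] /=; first by rewrite blin0 subrr.
  by rewrite blinD IH opprB addrA addrAC.
have rle n : `|r n| <= 2^-1 ^+ n * `|y|.
  elim: n => [|n IH] /=; first by rewrite expr0 mul1r.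
  have [_ h] := gP (r n); rewrite exprS -mulrA (le_trans h)//.
  by rewrite ler_wpM2l// invr_ge0.
(* A negative [C] forces [y] to vanish; the estimates below require [C] to be nonnegative. *)
have [C0|C0] := ltP C 0.
  have y0 : y = 0.
    apply/eqP; rewrite -normr_le0 leNgt; apply/negP => y0.
    have [h _] := gP y; have := le_trans (normr_ge0 _) h.
    by rewrite leNgt nmulr_rlt0 ?y0.
  by exists 0; rewrite ?y0 ?blin0// !normr0 mulr0.
pose K := 2 * C * `|y|.
have K0 : 0 <= K by rewrite /K !mulr_ge0.
(* The factor 2 in [K] makes the bound telescope: [K] times the drop between consecutive powers of
   one half is exactly the bound on the correction at that step. *)
have Sle m p : `|S (m + p)%N - S m| <= K * (2^-1 ^+ m - 2^-1 ^+ (m + p)).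
  elim: p => [|p IH]; first by rewrite addn0 !subrr normr0 mulr0.
  rewrite addnS /= addrAC (le_trans (ler_normD _ _))//.
  have [h _] := gP (r (m + p)%N).
  have h2 : `|g (r (m + p)%N)| <= C * (2^-1 ^+ (m + p) * `|y|).
    by rewrite (le_trans h)// ler_wpM2l.
  rewrite (le_trans (lerD IH h2))// exprS /K le_eqVlt; apply/orP; left.
  by apply/eqP; field.
have Sle' m p : (m <= p)%N -> `|S p - S m| <= K * 2^-1 ^+ m.
  move=> mp; rewrite -(subnKC mp) (le_trans (Sle _ _))// ler_wpM2l//.
  by rewrite gerBl exprn_ge0// invr_ge0.
have half0 : (fun n => 2^-1 ^+ n : R) @ \oo --> 0.
  by apply: cvg_expr; rewrite ger0_norm ?invr_ge0// invf_lt1// ltr1n.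
have K2 (M : R) : (fun n => M * 2^-1 ^+ n : R) @ \oo --> 0.
  by rewrite -[0](mulr0 M); apply: cvgM half0; exact: cvg_cst.
have /cE/cvg_ex[l Sl] : cauchy (S @ \oo).
  apply/cauchy_exP => e e0.
  have /cvgrPdist_lt/(_ e e0)[N _ NP] := K2 K.
  exists (S N); exists N => // n /= Nn.
  rewrite -ball_normE /= distrC (le_lt_trans (Sle' _ _ Nn))//.
  have := NP N (leqnn N); rewrite /= sub0r normrN ger0_norm//.
  by rewrite mulr_ge0// exprn_ge0// invr_ge0.
exists l.
  have TSl : (fun n => T (S n)) @ \oo --> T l.
    by apply: continuous_cvg Sl; exact: blin_continuous.
  have TSy : (fun n => T (S n)) @ \oo --> y.
    apply/cvgrPdist_lt => e e0.
    have /cvgrPdist_lt/(_ e e0) := K2 `|y|; apply: filterS => n.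
    rewrite TS subKr sub0r normrN ger0_norm; last first.
      by rewrite mulr_ge0// exprn_ge0// invr_ge0.
    by apply: le_lt_trans; rewrite mulrC.
  exact: (cvg_unique _ TSl TSy).
apply: (cvgr_to_le (cvg_norm Sl)).
near=> n; have := Sle' 0%N n (leq0n n); rewrite /= subr0 expr0 mulr1.
exact.
Unshelve. all: by end_near. Qed.

End BoundedOperators.

(* Open mapping theorem: by Baire, the closure of the image of some ball has an
   interior point, which yields approximate preimages. *)
Lemma surjective_bounded_preimage (R : realType) (E : normedModType R)
    (F : completeNormedModType R) (T : blin E F) : seq_complete E ->
  (forall y, exists e, T e = y) ->
  exists C, forall y, exists2 e, T e = y & `|e| <= C * `|y|.
Proof.
move=> cE surjT.
pose B n := closure (T @` [set e | `|e| <= n%:R]).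
(* If every complement were dense, Baire would give a point outside all [B n], against
   surjectivity. *)
have [n nB] : exists n, ~ dense (~` B n).
  apply: contrapT => /forallNP nB.
  have : dense (\bigcap_n ~` B n).
    apply: Baire => n; split; first exact/closed_openC/closed_closure.
    exact: contrapT (nB n).
  move=> /(_ setT); case => [|//|y [_ /= yB]]; [by exists 0|exact: openT|].
  have [e ey] := surjT y.
  apply: (yB (Num.truncn `|e|).+1) => //; apply: subset_closure; exists e => //=.
  by rewrite ltW// -truncn_le_nat.
have [y0 [r r0 y0B]] : exists y0, exists2 r, 0 < r & ball y0 r `<=` B n.
  move: nB => /denseNE[D [[x /open_nbhs_nbhs/nbhs_ballP[r r0 bO]] OB]].
  exists x; exists r; first by []. move=> z /bO Dz; apply: contrapT => Bz.
  by have : (D `&` ~` B n) z by []; rewrite OB.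
have half : forall y : F, exists2 e, `|e| <= 4 * n%:R / r * `|y| &
    `|y - T e| <= 2^-1 * `|y|.
  move=> y; have [->|yN0] := eqVneq y 0.
    by exists 0; rewrite ?blin0 ?subrr !normr0 mulr0.
  have ny : 0 < `|y| by rewrite normr_gt0.
  (* The vector [s *: y] has norm [r / 2], so [y0 + s *: y] stays in the ball. Approximating this
     point and [y0] within [r / 8] approximates the difference [s *: y] within [r / 4], half its
     norm. *)
  pose s := r / (2 * `|y|).
  have s0 : 0 < s by rewrite divr_gt0// mulr_gt0.
  have nearT z : ball y0 r z ->
      exists2 e, `|e| <= n%:R & `|z - T e| < r / 8.
    move=> /y0B/(_ _ (nbhsx_ballx z _ (divr_gt0 r0 (ltr0n R 8))))[_ [[e /= en <-]]].
    by rewrite -ball_normE; exists e.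
  have [e1 e1n h1] : exists2 e, `|e| <= n%:R & `|(y0 + s *: y) - T e| < r / 8.
    apply: nearT; rewrite -ball_normE /ball_ /= opprD addNKr normrN normrZ.
    rewrite gtr0_norm// /s invfM mulrA mulfVK ?gt_eqF//.
    by rewrite ltr_pdivrMr// ltr_pMr// ltr1n.
  have [e2 e2n h2] : exists2 e, `|e| <= n%:R & `|y0 - T e| < r / 8.
    by apply: nearT; exact: ballxx.
  exists (s^-1 *: (e1 - e2)).
    rewrite normrZ gtr0_norm ?invr_gt0//.
    have : `|e1 - e2| <= n%:R + n%:R.
      by rewrite (le_trans (ler_normB _ _))// lerD.
    move=> /(ler_wpM2l (ltW (_ : 0 < s^-1))); rewrite invr_gt0 => /(_ s0).
    move=> /le_trans; apply; rewrite /s le_eqVlt; apply/orP; left.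
    by apply/eqP; field; rewrite !gt_eqF.
  have -> : y - T (s^-1 *: (e1 - e2)) =
      s^-1 *: ((y0 + s *: y - T e1) - (y0 - T e2)).
    rewrite blinZ blinB -[X in X - _](scalerK (lt0r_neq0 s0)) -scalerBr.
    congr (_ *: _); rewrite !opprB [y0 + _]addrC -!addrA; congr (_ + _).
    by rewrite [RHS]addrC -!addrA addNr addr0 addrC.
  rewrite normrZ gtr0_norm ?invr_gt0// ler_pdivrMl//.
  rewrite (le_trans (ler_normB _ _))//.
  have -> : s * (2^-1 * `|y|) = r / 8 + r / 8.
    by rewrite /s; field; rewrite gt_eqF.
  by rewrite lerD// ltW.
by have := approx_solvable cE half; exists (2 * (4 * n%:R / r)).
Qed.

(* Solutions of T serve as approximate solutions for the nearby operator S. *)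
Lemma perturbed_isomorphism (R : realType) (E F : normedModType R)
    (T S : blin E F) (C d : R) : seq_complete E -> C * d <= 2^-1 -> 0 <= C ->
  (forall y, exists2 e, T e = y & `|e| <= C * `|y|) ->
  (forall e, T e = 0 -> e = 0) ->
  (forall e, `|S e - T e| <= d * `|e|) ->
  isomorphism S.
Proof.
move=> cE Cd C0 surjT injT ST.
have Tle e : `|e| <= C * `|T e|.
  have [e' Te' h] := surjT (T e).
  have /injT/subr0_eq e'e : T (e' - e) = 0 by rewrite blinB Te' subrr.
  by rewrite -[X in `|X|]e'e.
(* The [T]-preimage [e] of [y] leaves the residual [T e - S e], at most [C * d] times the norm of
   [y], hence at most half of it. *)
have half y : exists2 e, `|e| <= C * `|y| & `|y - S e| <= 2^-1 * `|y|.
  have [e Te eC] := surjT y; exists e => //.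
  rewrite -{1}Te distrC (le_trans (ST e))//.
  have [d0|d0] := leP d 0.
    by rewrite (@le_trans _ _ 0)// ?mulr_le0_ge0// mulr_ge0// invr_ge0.
  by rewrite (le_trans (ler_wpM2l (ltW d0) eC))// mulrA ler_wpM2r// mulrC.
have /(_ _)/cid2-/all_sig[S' S'P] := approx_solvable cE half.
(* For [e] in the kernel of [S], the norm of [e] is at most [C * d] times itself, hence at most half
   of itself. *)
have Sinj e : S e = 0 -> e = 0.
  move=> Se; apply/eqP; rewrite -normr_le0.
  have := ST e; rewrite Se sub0r normrN => h.
  have h2 := le_trans (Tle e) (ler_wpM2l C0 h).
  have h3 : C * (d * `|e|) <= 2^-1 * `|e| by rewrite mulrA ler_wpM2r.
  by have := le_trans h2 h3; have := normr_ge0 e; lra.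
have Sinj' : injective S.
  move=> u v uv; apply/subr0_eq/Sinj.
  by rewrite blinB uv subrr.
split; [exact: blin_linear|exact: blin_continuous|exists S'].
have S'K : cancel S' S by move=> y; have [] := S'P y.
have SK : cancel S S' by move=> e; apply: Sinj'; rewrite S'K.
split => //; apply: (@linear_fun_bounded_continuous _ _ _ _ (2 * C)).
  by move=> a u v; apply: Sinj'; rewrite S'K blinD blinZ !S'K.
by move=> y; have [] := S'P y.
Qed.

(** * Direct decompositions *)

Section LinearAlgebra.
Context {R : realType} {E : normedModType R}.

(** Steinitz exchange modulo [S]: the coefficients of the [b j] form an [m] by [p] matrix, and for
    [p < m] a nonzero row vector killed by it gives a nontrivial combination of the [b j] lying in
    [S]. *)
Lemma independent_le_generating (S : submodClosed E) m p
    (b : 'I_m -> E) (y : 'I_p -> E) :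
  (forall a : 'I_m -> R, \sum_i a i *: b i \in S -> forall i, a i = 0) ->
  (forall j, exists a : 'I_p -> R, b j - \sum_i a i *: y i \in S) ->
  (m <= p)%N.
Proof.
move=> bfree /choice[a ba]; rewrite leqNgt; apply/negP => pm.
pose A : 'M[R]_(m, p) := \matrix_(j, i) a j i.
have : kermx A != 0.
  rewrite -mxrank_eq0 mxrank_ker subn_eq0 -ltnNge.
  exact: leq_ltn_trans (rank_leq_col A) pm.
move=> /rowV0Pn[u /sub_kermxP uA].
apply/negP; rewrite negbK; apply/eqP/rowP => j; rewrite mxE.
apply: (bfree (fun j => u 0 j)) => {j}.
have -> : \sum_j u 0 j *: b j =
    \sum_j u 0 j *: (b j - \sum_i a j i *: y i).
  under [RHS]eq_bigr do rewrite scalerBr.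
  rewrite sumrB; apply/esym/eqP; rewrite subr_eq addrC -subr_eq subrr eq_sym.
  apply/eqP; under eq_bigr do rewrite scaler_sumr.
  rewrite exchange_big big1//= => i _.
  under eq_bigr do rewrite scalerA.
  rewrite -scaler_suml [X in X *: _](_ : _ = (u *m A) 0 i).
    by rewrite uA mxE scale0r.
  by rewrite mxE; apply: eq_bigr => j _; rewrite mxE.
by apply: rpred_sum => j _; rewrite rpredZ.
Qed.

Context {n : nat} (y_ : 'I_n -> E) (S : submodClosed E).
Hypothesis yS : direct_decomposition (fun i => line (y_ i)) S.

Lemma mem_line (v : E) (a : R) : a *: v \in line v.
Proof. by apply/asboolP; exists a. Qed.

Lemma decomposition_coordinates e :
  exists (a : 'I_n -> R) w, w \in S /\ e = \sum_i a i *: y_ i + w.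
Proof.
have [v [w [vl wS ->]]] := yS.1 e.
have /choice[a va] : forall i, exists a, v i = a *: y_ i.
  by move=> i; apply/asboolP; exact: vl.
by exists a, w; split => //; under eq_bigr do rewrite va.
Qed.

Lemma projection_coordinates i (P : {linear E -> E}) (a : 'I_n -> R) w :
  projection_onto_along P (line (y_ i)) (addsp (hatsp y_ i) S) ->
  w \in S -> P (\sum_j a j *: y_ j + w) = a i *: y_ i.
Proof.
move=> Pproj wS; rewrite (bigD1 i)//= -addrA Pproj ?mem_line//.
apply/asboolP; exists (\sum_(j | j != i) a j *: y_ j), w; split => //.
by apply/asboolP; exists (fun j => a j *: y_ j); split => // j _; exact: mem_line.
Qed.

(** [direct_decomposition] admits zero generators, since their lines are trivial. A zero [y_ i]
    would leave [n.-1] vectors generating [E] modulo [S], fewer than the codimension. *)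
Lemma decomposition_generators_neq0 q :
  has_codim q [set` S] -> (n <= q)%N -> forall i, y_ i != 0.
Proof.
move=> [b [bfree _]] nq i; apply/eqP => yi0.
have n0 : (0 < n)%N by apply: leq_trans (ltn_ord i).
suff : (q <= n.-1)%N by rewrite leqNgt prednK// nq.
apply: (@independent_le_generating S _ _ b (y_ \o lift i)) => // j.
have [a [w [wS ->]]] := decomposition_coordinates (b j).
exists (a \o lift i); rewrite [X in X + w - _](bigD1_ord i)//= yi0 scaler0 add0r.
by rewrite addrAC subrr add0r.
Qed.

End LinearAlgebra.

Lemma has_dim_unique_le (R : realType) (E : normedModType R) m p (K : set E) :
  has_dim m K -> has_dim p K -> (m <= p)%N.
Proof.
move=> [b [bfree bK]] [d [_ dK]].
apply: (@independent_le_generating _ _ (line 0) _ _ b d) => [a /asboolP[t]|j].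
  by rewrite scaler0; exact: bfree.
have : K (b j).
  rewrite bK; exists (fun i => (i == j)%:R).
  rewrite (bigD1 j)//= eqxx scale1r big1 ?addr0// => i /negbTE ->.
  by rewrite scale0r.
rewrite dK => -[a ->]; exists a; rewrite subrr.
by apply/asboolP; exists 0; rewrite scaler0.
Qed.

(** The coordinate map [f] is a bounded surjection from a Banach space, so by the open mapping
    theorem coordinates can be chosen bounded by the norm of the vector; [P] only reads the [i]-th
    one. *)
Lemma projection_continuous (R : realType) (Y : completeNormedModType R) n
    (y_ : 'I_n -> Y) (Yt : submodClosed Y) i (P : {linear Y -> Y}) :
  closed [set` Yt] -> direct_decomposition (fun i => line (y_ i)) Yt ->
  projection_onto_along P (line (y_ i)) (addsp (hatsp y_ i) Yt) ->
  continuous P.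
Proof.
move=> clYt yYt Pproj.
pose f (wa : subsp Yt * 'rV[R]_n) : Y := \sum_j wa.2 0 j *: y_ j + val wa.1.
have lf : linear f.
  move=> a u v; rewrite /f /= !scalerDr addrACA; congr (_ + _).
  rewrite scaler_sumr -big_split; apply: eq_bigr => j _ /=.
  by rewrite !mxE scalerDl scalerA.
have coordle (b : 'rV[R]_n) j : `|b 0 j| <= `|b|.
  by rewrite [leRHS]mx_normrE; apply: (le_bigmax _ (fun ij => `|b ij.1 ij.2|) (0, j)).
have cf : continuous f.
  apply: (@linear_fun_bounded_continuous _ _ _ _ (\sum_j `|y_ j| + 1)) => // u.
  rewrite (le_trans (ler_normD _ _))// mulrDl mul1r lerD//.
    rewrite (le_trans (ler_norm_sum _ _ _))// mulr_suml ler_sum// => j _.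
    rewrite normrZ mulrC ler_wpM2l// (le_trans (coordle _ _))//.
    by rewrite prod_normE le_max lexx orbT.
  by rewrite prod_normE le_max lexx.
have sf y : exists e, Blin lf cf e = y.
  have [a [w [wS ->]]] := decomposition_coordinates yYt y.
  exists (Sub w wS, \row_j a j); rewrite /= /f /=; congr (_ + _).
  by apply: eq_bigr => j _; rewrite mxE.
have [|C CP] := surjective_bounded_preimage _ sf.
  by apply: prod_seq_complete; [exact: subsp_seq_complete|exact: rV_seq_complete].
apply: (@linear_fun_bounded_continuous _ _ _ P (C * `|y_ i|)) => [a u v|y].
  exact: linearP.
have [e <- eC] := CP y.
rewrite -[X in `|P X|]/(f e) (projection_coordinates (fun j => e.2 0 j) Pproj) ?(valP e.1)//.
rewrite normrZ mulrAC ler_wpM2r// (le_trans (coordle _ _))//.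
by rewrite (le_trans _ eC)// prod_normE le_max lexx orbT.
Qed.

(** * Derivatives *)

Section Differentials.
Context {R : realType}.

Lemma is_diff_blin (E F : normedModType R) (T : blin E F) x : is_diff x T T.
Proof.
have cT : continuous T := @blin_continuous _ _ _ T.
by apply: DiffDef; [exact: linear_differentiable|exact: diff_lin].
Qed.

Lemma is_diff_remainder (E F : normedModType R) (f df : E -> F) x (eta : R) :
  is_diff x f df -> 0 < eta ->
  \forall h \near 0, `|f (h + x) - f x - df h| <= eta * `|h|.
Proof.
move=> dfx eta0; have := @ex_diff _ _ _ _ _ _ _ dfx.
move=> /diff_locallyP[_]; rewrite diff_val => /eqaddoP/(_ _ eta0).
by apply: filterS => h; rewrite !fctE /= opprD addrA.
Qed.

Lemma blin_le (E F : normedModType R) (T : blin E F) u : `|T u| <= `|T| * `|u|.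
Proof. exact: opnorm_ub. Qed.

Lemma blin_le2 (E F G : normedModType R) (T : blin E (blin F G)) u v :
  `|(T u : blin F G) v| <= `|T| * `|u| * `|v|.
Proof. by rewrite (le_trans (blin_le _ _))// ler_wpM2r// blin_le. Qed.

(** Evaluation at [u] is a bounded linear map on [blin E F], so the chain rule applies. *)
Lemma is_diff_eval (D E F : normedModType R) (f df : D -> blin E F) x u :
  is_diff x f df -> is_diff x (fun y => f y u) (fun h => df h u).
Proof.
move=> dfx.
have lev : linear (fun T : blin E F => T u) by [].
have cev : continuous (fun T : blin E F => T u).
  apply: (@linear_fun_bounded_continuous _ _ _ _ `|u|) => // T.
  by rewrite mulrC blin_le.
exact: is_diff_comp dfx (is_diff_blin (Blin lev cev) (f x)).
Qed.

(* Difference quotients of f along v stay in K, hence so does their limit. *)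
Lemma diff_mem_closed (E F : normedModType R) (f df : E -> F) x v
    (K : submodClosed F) : closed [set` K] -> is_diff x f df ->
  (forall a : R, f (a *: v + x) \in K) -> df v \in K.
Proof.
move=> clK dfx fK; have dx := @ex_diff _ _ _ _ _ _ _ dfx.
rewrite -(@diff_val _ _ _ _ _ _ _ dfx) -deriveE//.
have dv := @diff_derivable _ _ _ _ _ v dx.
apply: (@closed_cvg _ _ _ _ _ [set` K] clK _ _ dv); near=> h.
have fx : f x \in K by rewrite -[x in f x]add0r -[X in X + x](scale0r v).
by rewrite -scaleN1r; apply/rpredZ/rpredD; [exact: fK|exact: rpredZ].
Unshelve. all: by end_near. Qed.

Context {X Y : normedModType R} {n : nat}.
Local Notation Z := (X * 'rV[R]_n)%type.

Lemma is_diff_fst_partial (W : normedModType R) (f : Z -> W)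
    (df : Z -> blin Z W) :
  (forall z, is_diff z f (df z)) -> forall x c,
  is_diff x (fun x' => f (x', c)) (fun v => df (x, c) (v, 0)).
Proof.
move=> dfz x c; have h : is_diff x (fun x' : X => (x', c)) (fun v : X => (v, 0 : 'rV[R]_n)).
  exact: is_diff_pair.
exact: (is_diff_comp h (dfz (x, c))).
Qed.

Variables (F : Z -> Y) (DF : Z -> blin Z Y).
Hypothesis dF : forall z, is_diff z F (DF z).

Lemma D1E x c v : D1 F x c v = DF (x, c) (v, 0).
Proof.
have h := is_diff_fst_partial dF x c.
by rewrite /D1 (@diff_val _ _ _ _ _ _ _ h).
Qed.

Lemma DcE j x c t : Dc F j x c t = DF (x, c) (0, t *: delta_mx 0 j).
Proof.
(* [set_coord c j] is affine in its last argument; its constant term is [c] with the [j]-th entry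
   set to zero. *)
have sE : set_coord c j =
    (fun t : R^o => t *: delta_mx 0 j : 'rV[R]_n) + cst (set_coord c j 0).
  apply/funext => s; apply/rowP => l; rewrite !fctE !mxE /=.
  by case: eqP => _; rewrite ?mulr1 ?addr0 ?mulr0 ?add0r.
have sc : set_coord c j (c 0 j) = c.
  by apply/rowP => l; rewrite mxE; case: eqP => // ->.
have h1 : is_diff (c 0 j : R^o) (set_coord c j : R^o -> 'rV[R]_n)
    (fun t : R^o => t *: delta_mx 0 j : 'rV[R]_n).
  rewrite sE; apply: is_diff_eq; apply/funext => s.
  by rewrite !fctE addr0.
have h2 : is_diff (c 0 j : R^o) (fun t : R^o => (x, set_coord c j t))
    (fun t : R^o => (0 : X, t *: delta_mx 0 j : 'rV[R]_n)).
  exact: is_diff_pair.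
have h3 : is_diff (x, set_coord c j (c 0 j)) F (DF (x, c)) by rewrite sc.
have h := is_diff_comp h2 h3.
by rewrite /Dc (@diff_val _ _ _ _ _ _ _ h).
Qed.

Lemma D1DcE (D2F : Z -> blin Z (blin Z Y)) :
  (forall z, is_diff z DF (D2F z)) -> forall j x c v t,
  D1Dc F j x c v t = (D2F (x, c) (v, 0) : blin Z Y) (0, t *: delta_mx 0 j).
Proof.
move=> d2F j x c v t; rewrite /D1Dc.
rewrite (_ : (fun x' => Dc F j x' c t) =
  (fun x' => DF (x', c) (0, t *: delta_mx 0 j))); last first.
  by apply/funext => x'; rewrite DcE.
have h := is_diff_eval (0, t *: delta_mx 0 j) (is_diff_fst_partial d2F x c).
by rewrite (@diff_val _ _ _ _ _ _ _ h).
Qed.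

Lemma subsp_val_continuous (S : submodClosed X) : continuous (val : subsp S -> X).
Proof.
apply: (@linear_fun_bounded_continuous _ _ _ _ 1) => [a u v|u].
  by rewrite linearP.
by rewrite mul1r.
Qed.

(** By the chain rule both partial derivatives of [G] are restrictions of the total derivative, so
    norm estimates can be made on [DF] alone. *)
Lemma AE (x_ : 'I_n -> X) (Xt : submodClosed X) xt c s vb :
  A F x_ xt c s vb =
  DF (\sum_i s 0 i *: x_ i + val (xt s : subsp Xt), c s) (val vb.1, vb.2).
Proof.
set z := (_, c s).
have lval : linear (val : subsp Xt -> X) by move=> a u v; rewrite linearP.
have dval (v : subsp Xt) : is_diff v (val : subsp Xt -> X) val.
  exact: (is_diff_blin (Blin lval (@subsp_val_continuous _))).
have h1 : is_diff (xt s) (fun xt' => G F x_ xt' (c s) s) (fun v => DF z (val v, 0)).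
  have h2 : is_diff (xt s)
      (fun v : subsp Xt => (\sum_i s 0 i *: x_ i + val v, c s))
      (fun v : subsp Xt => (val v, 0 : 'rV[R]_n)).
    have h3 : is_diff (xt s) (fun v : subsp Xt => \sum_i s 0 i *: x_ i + val v)
        (val : subsp Xt -> X).
      have := is_diffD (is_diff_cst (\sum_i s 0 i *: x_ i) (xt s)) (dval (xt s)).
      by rewrite add0r.
    exact: is_diff_pair.
  exact: (is_diff_comp h2 (dF z)).
have h2 : is_diff (c s) (fun c' => G F x_ (xt s) c' s) (fun b => DF z (0, b)).
  have h3 : is_diff (c s)
      (fun c' : 'rV[R]_n => (\sum_i s 0 i *: x_ i + val (xt s), c'))
      (fun b : 'rV[R]_n => (0 : X, b)).
    exact: is_diff_pair.
  exact: (is_diff_comp h3 (dF z)).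
rewrite /A (@diff_val _ _ _ _ _ _ _ h1) (@diff_val _ _ _ _ _ _ _ h2).
by rewrite -blinD; congr (DF z _); congr pair; rewrite /= ?addr0 ?add0r.
Qed.

End Differentials.

(** Reduces the three smoothness classes to two Fréchet derivatives, on which the expansion at the
    bifurcation point rests. *)
Lemma smooth_second_derivative (R : realType) (E F : normedModType R)
    (k : smoothness) (f : E -> F) : at_least_C2 k -> smooth_on k setT f ->
  exists (Df : E -> blin E F) (D2f : E -> blin E (blin E F)),
    (forall x, is_diff x f (Df x)) /\ (forall x, is_diff x Df (D2f x)).
Proof.
move=> k2 fk; have [m [Df Dff [D2f D2ff _]]] : exists m, Ck_on m.+2 setT f.
  case: k k2 fk => [[|[|m]]//= _ fm|_ fk|_ [fk _]]; first by exists m.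
  - by exists 0%N; exact: fk.
  - by exists 0%N; exact: fk.
by exists Df, D2f; split => x; [exact: Dff|exact: D2ff].
Qed.

(** * The limit operator *)

Section Singletons.
Context {R : realType} {E : normedModType R}.

Lemma closed_singleton (e : E) : closed [set e].
Proof.
exact: accessible_closed_set1 (hausdorff_accessible (@norm_hausdorff _ _)) e.
Qed.

Lemma mem_line0 (e : E) : (e \in line (0 : E)) = (e == 0).
Proof.
apply/asboolP/eqP => [[a ->]|->]; first by rewrite scaler0.
by exists 0; rewrite scaler0.
Qed.

(** Allows [diff_mem_closed] with the zero subspace as [K]: a map vanishing along a line has zero
    derivative in its direction. *)
Lemma closed_line0 : closed [set` line (0 : E)].
Proof.
rewrite (_ : [set` _] = [set 0]); first exact: closed_singleton.
by apply/seteqP; split => e /=; rewrite mem_line0 => /eqP.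
Qed.

End Singletons.

Section Isomorphisms.
Context {R : realType}.

Lemma isomorphism_comp (E F G : normedModType R) (f : E -> F) (g : F -> G) :
  isomorphism f -> isomorphism g -> isomorphism (g \o f).
Proof.
move=> [lf cf [f' [cf' fK f'K]]] [lg cg [g' [cg' gK g'K]]]; split.
- by move=> a u v; rewrite /= lf lg.
- by move=> u; apply: continuous_comp; [exact: cf|exact: cg].
exists (f' \o g'); split.
- by move=> u; apply: continuous_comp; [exact: cg'|exact: cf'].
- exact: can_comp.
- exact: can_comp.
Qed.

Lemma scale_snd_linear (E V : normedModType R) (r : R) :
  linear (fun u : E * V => (u.1, r *: u.2)).
Proof.
move=> a u v; congr pair => //=.
by rewrite scalerDr !scalerA mulrC.
Qed.

Lemma scale_snd_continuous (E V : normedModType R) (r : R) :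
  continuous (fun u : E * V => (u.1, r *: u.2)).
Proof.
apply: (@linear_fun_bounded_continuous _ _ _ _ (1 + `|r|)) => [|u].
  exact: scale_snd_linear.
rewrite !prod_normE /= ge_max normrZ; apply/andP; split.
  rewrite -[leLHS]mul1r ler_pM// ?lerDl//.
  by rewrite le_max lexx.
by rewrite ler_pM// ?lerDr// le_max lexx orbT.
Qed.

Lemma isomorphism_scale_snd (E V : normedModType R) (r : R) : r != 0 ->
  isomorphism (fun u : E * V => (u.1, r *: u.2)).
Proof.
move=> r0; split; [exact: scale_snd_linear|exact: scale_snd_continuous|].
exists (fun u => (u.1, r^-1 *: u.2)); split; first exact: scale_snd_continuous.
- by move=> [u v] /=; rewrite scalerK.
- by move=> [u v] /=; rewrite scalerKV.
Qed.

End Isomorphisms.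

(** * Bijectivity of the block triangular operator *)

Section BlockOperator.
Context {R : realType} {X Y : normedModType R} {n : nat}.
Variables (x_ : 'I_n -> X) (y_ : 'I_n -> Y).
Variables (Xt : submodClosed X) (Yt : submodClosed Y).
Variables (L : {linear X -> Y}) (P : 'I_n -> {linear Y -> Y}).
Hypothesis L_ker : kernel_of L = [set` sumsp predT (fun i => line (x_ i))].
Hypothesis Yt_range : [set` Yt] = range L.
Hypothesis X_dec : direct_decomposition (fun i => line (x_ i)) Xt.
Hypothesis Y_dec : direct_decomposition (fun i => line (y_ i)) Yt.
Hypothesis P_proj : forall i,
  projection_onto_along (P i) (line (y_ i)) (addsp (hatsp y_ i) Yt).

Lemma range_mem u : L u \in Yt.
Proof. by have : [set` Yt] (L u) by rewrite Yt_range; exists u. Qed.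

Lemma projection_range i u : P i (L u) = 0.
Proof.
have := projection_coordinates (fun=> 0) (@P_proj i) (range_mem u).
by rewrite big1 ?add0r ?scale0r// => j _; rewrite scale0r.
Qed.

Lemma mem_of_projections_eq0 e : (forall i, P i e = 0) -> e \in Yt.
Proof.
have [a [w [wS ->]]] := decomposition_coordinates Y_dec e => Pe.
rewrite big1 ?add0r// => i _; rewrite -(Pe i).
by rewrite (projection_coordinates _ (@P_proj i)).
Qed.

Lemma complement_range e : e \in Yt -> exists v : subsp Xt, L (val v) = e.
Proof.
move=> eY; have : [set` Yt] e by [].
rewrite Yt_range => -[u _ <-].
have [v [w [vl wX ->]]] := X_dec.1 u; exists (Sub w wX).
have : kernel_of L (\sum_i v i).
  by rewrite L_ker /=; apply/asboolP; exists v; split => // i _; exact: vl.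
by rewrite /kernel_of /= => Lv; rewrite linearD Lv add0r.
Qed.

Lemma complement_inj (v : subsp Xt) : L (val v) = 0 -> v = 0.
Proof.
move=> Lv; have : kernel_of L (val v) by [].
rewrite L_ker => /asboolP[w [wl vw]].
have [//|||_ v0] := X_dec.2 w (- val v).
- by move=> i; exact: wl.
- by rewrite -scaleN1r rpredZ// (valP v).
- by rewrite vw subrr.
by apply: val_inj; apply: oppr_inj; rewrite v0 raddf0 ?oppr0.
Qed.

Context {M : 'rV[R]_n -> Y} {N : 'M[R]_n}.
Hypothesis y_neq0 : forall i, y_ i != 0.
Hypothesis N_unit : N \in unitmx.
Hypothesis PM : forall i b, P i (M b) = (N *m b^T) i 0 *: y_ i.

(** The parameter [b] is chosen so that [M b] has the same projections as [e]; the difference then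
    lies in the range of [L], which [L] already fills from [Xt]. *)
Lemma block_surjective e :
  exists vb : subsp Xt * 'rV[R]_n, L (val vb.1) + M vb.2 = e.
Proof.
have [a [w [wS ->]]] := decomposition_coordinates Y_dec e.
pose b : 'rV[R]_n := (invmx N *m \col_i a i)^T.
have [|v Lv] := @complement_range (\sum_i a i *: y_ i + w - M b); last first.
  by exists (v, b); rewrite /= Lv subrK.
apply: mem_of_projections_eq0 => i.
rewrite linearB /= (projection_coordinates _ (@P_proj i))// PM.
by rewrite trmxK mulKVmx// mxE subrr.
Qed.

(** Applying [P i] removes the [L] term and leaves [N *m b^T = 0], because the [y_ i] are nonzero;
    so [b = 0], and [L] is injective on [Xt]. *)
Lemma block_injective (vb : subsp Xt * 'rV[R]_n) : M 0 = 0 ->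
  L (val vb.1) + M vb.2 = 0 -> vb = 0.
Proof.
case: vb => v b /= M0 Lvb.
have Nb : N *m b^T = 0.
  apply/matrixP => i j; rewrite ord1 [RHS]mxE; apply/eqP.
  have := congr1 (P i) Lvb.
  rewrite linearD /= projection_range add0r PM linear0 => /eqP.
  by rewrite scaler_eq0 (negPf (y_neq0 i)) orbF.
have b0 : b = 0.
  by rewrite -[b]trmxK -[b^T](mulKmx N_unit) Nb mulmx0 trmx0.
move: Lvb; rewrite b0 M0 addr0 => /complement_inj ->.
by [].
Qed.

End BlockOperator.

(** This complement is the kernel of the continuous projection [P]. Closedness lets it contain
    limits of difference quotients. *)
Lemma projection_kernel_closed (R : realType) (Y : completeNormedModType R) n
    (y_ : 'I_n -> Y) (Yt : submodClosed Y) i (P : {linear Y -> Y}) :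
  closed [set` Yt] -> direct_decomposition (fun i => line (y_ i)) Yt ->
  projection_onto_along P (line (y_ i)) (addsp (hatsp y_ i) Yt) ->
  closed [set` addsp (hatsp y_ i) Yt].
Proof.
move=> clYt yYt Pproj.
have cP := projection_continuous clYt yYt Pproj.
rewrite (_ : [set` _] = P @^-1` [set 0]).
  apply: preimage_closed; first by move=> y _; exact: cP.
  exact: closed_singleton.
apply/seteqP; split => e /= => [eK|Pe].
  by have := Pproj 0 e (rpred0 _) eK; rewrite add0r.
have [a [w [wS ee]]] := decomposition_coordinates yYt e.
have ai : a i *: y_ i = 0 by rewrite -Pe ee (projection_coordinates _ Pproj).
apply/asboolP; exists (\sum_(j | j != i) a j *: y_ j), w; split => //.
  by apply/asboolP; exists (fun j => a j *: y_ j); split => // j _; exact: mem_line.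
by rewrite ee (bigD1 i)//= ai add0r.
Qed.

(** * First-order expansion of the derivative at the trivial branch *)

Section MixedDerivative.
Context {R : realType} {X Y : normedModType R} {n : nat}.
Local Notation Z := (X * 'rV[R]_n)%type.
Variables (F : Z -> Y) (DF : Z -> blin Z Y) (D2F : Z -> blin Z (blin Z Y)).
Hypothesis dF : forall z, is_diff z F (DF z).
Hypothesis d2F : forall z, is_diff z DF (D2F z).

(** Difference quotients stay in the closed subspace [K] twice: first in the parameter direction at
    each point [a *: v], then along the line through [v]. *)
Lemma mixed_derivative_mem (K : submodClosed Y) v c b : closed [set` K] ->
  (forall (a : R) c, F (a *: v, c) \in K) ->
  (D2F (0, c) (v, 0) : blin Z Y) (0, b) \in K.
Proof.
move=> clK FK.
have DFK a : DF (a *: v, c) (0, b) \in K.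
  apply: (diff_mem_closed clK (dF (a *: v, c))) => t.
  rewrite (_ : _ + _ = (a *: v, t *: b + c)) ?FK//.
  by congr pair; rewrite /= scaler0 add0r.
have h := is_diff_eval (0, b) (d2F (0, c)).
apply: (diff_mem_closed clK h) => t /=.
rewrite (_ : _ + _ = (t *: v, c)) ?DFK//.
by congr pair; rewrite /= ?scaler0 ?addr0 ?add0r.
Qed.

Hypothesis F_trivial : forall c, F (0, c) = 0.

Lemma trivial_branch_derivative c b : DF (0, c) (0, b) = 0.
Proof.
have : DF (0, c) (0, b) \in line (0 : Y).
  apply: (diff_mem_closed closed_line0 (dF (0, c))) => t.
  rewrite (_ : _ + _ = (0, t *: b + c)) ?F_trivial ?rpred0//.
  by congr pair; rewrite /= scaler0 addr0.
by rewrite mem_line0 => /eqP.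
Qed.

(** [DF (0, c) (0, b)] vanishes for every [c], hence so does its derivative in a parameter
    direction. *)
Lemma trivial_branch_second_derivative c g b :
  (D2F (0, c) (0, g) : blin Z Y) (0, b) = 0.
Proof.
have h := is_diff_eval (0, b) (d2F (0, c)).
have : (D2F (0, c) (0, g) : blin Z Y) (0, b) \in line (0 : Y).
  apply: (diff_mem_closed closed_line0 h) => t.
  rewrite /= (_ : _ + _ = (0, t *: g + c)) ?trivial_branch_derivative ?rpred0//.
  by congr pair; rewrite /= scaler0 addr0.
by rewrite mem_line0 => /eqP.
Qed.

(** Expand [DF] at [(0, c)] with displacement [h] of order [r]. On [(v, 0)] continuity of [DF]
    suffices. On [(0, r^-1 *: b)] the zeroth-order term vanishes, the linear term is [r] times the
    mixed derivative in direction [u] up to [o(r)], and the remainder is [o(r)], so that dividing by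
    [r] is harmless. *)
Lemma rescaled_derivative_limit (z : R -> Z) c u (K d : R) : 0 < d ->
  (\forall r \near 0^'+, `|z r - (0, c)| <= K * r) ->
  (forall eta, 0 < eta -> \forall r \near 0^'+, `|(z r).1 - r *: u| <= eta * r) ->
  \forall r \near 0^'+, forall v b,
    `|DF (z r) (v, r^-1 *: b) -
      (DF (0, c) (v, 0) + (D2F (0, c) (u, 0) : blin Z Y) (0, b))| <=
    d * `|(v, b)|.
Proof.
move=> d0 zK zu.
set T := D2F (0, c).
wlog K0 : K zK / 0 <= K.
  move=> H; apply: (H `|K|) => //; near=> r.
  rewrite (@le_trans _ _ (K * r))//; first by near: r.
  by rewrite ler_wpM2r ?ler_norm// ltW//; near: r; exact: nbhs_right_gt.
(* [eta] bounds the relative error both of the expansion of [DF] and of the direction of [z r]. Its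
   value makes [eta] times the sum of [K] and the norm of [T] at most [d / 2]; the added 1 keeps the
   denominator positive. *)
pose eta := d / (2 * (K + `|T| + 1)).
have eta0 : 0 < eta.
  by rewrite divr_gt0// mulr_gt0// ltr_wpDl// addr_ge0.
have cvh : z r - (0, c) @[r --> 0^'+] --> (0 : Z).
  apply/cvgrPdist_le => e e0; near=> r.
  rewrite sub0r normrN (@le_trans _ _ (K * r))//; first by near: r.
  rewrite (@le_trans _ _ ((K + 1) * r))// ?ler_wpM2r ?lerDl//.
  rewrite mulrC -ler_pdivlMr ?ltr_wpDl//.
  by near: r; apply: nbhs_right_le; rewrite divr_gt0 ?ltr_wpDl.
have rem : \forall r \near 0^'+,
    `|DF (z r - (0, c) + (0, c)) - DF (0, c) - T (z r - (0, c))| <=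
    eta * `|z r - (0, c)|.
  exact: cvh _ (is_diff_remainder (d2F (0, c)) eta0).
have eTK : 0 < (eta + `|T|) * K + 1.
  by rewrite ltr_wpDl// mulr_ge0// addr_ge0// ltW.
near=> r => v b.
have r0 : 0 < r by near: r; exact: nbhs_right_gt.
have hK : `|z r - (0, c)| <= K * r by near: r.
have hu : `|(z r).1 - r *: u| <= eta * r by near: r; exact: zu.
have hrem : `|DF (z r) - DF (0, c) - T (z r - (0, c))| <= eta * `|z r - (0, c)|.
  by rewrite -{1}[z r](subrK (0, c)); near: r.
set h := z r - (0, c) in hK hrem *.
have rd : (eta + `|T|) * (K * r) <= d / 2.
  rewrite mulrA (@le_trans _ _ (((eta + `|T|) * K + 1) * r))//.
    by rewrite ler_wpM2r ?lerDl// ltW.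
  rewrite mulrC -ler_pdivlMr//.
  by near: r; apply: nbhs_right_le; rewrite divr_gt0 ?divr_gt0.
(* Only the middle term survives in the limit: the first is small by [hu], and the last vanishes on
   [(0, b)]. *)
have Th : T h = T ((z r).1 - r *: u, 0) + r *: T (u, 0) + T (0, h.2).
  rewrite -blinZ -!blinD; congr (T _).
  by congr pair; rewrite /= ?scaler0 !addr0 ?add0r// subrK// subr0.
pose D : blin Z Y := DF (z r) - DF (0, c).
have Dle : `|D| <= d / 2.
  rewrite -[D](subrK (T h)) (le_trans (ler_normD _ _))// (le_trans _ rd)//.
  rewrite mulrDl lerD//.
    by rewrite (le_trans hrem)// ler_wpM2l// ltW.
  by rewrite (le_trans (blin_le _ _))// ler_wpM2l.
have DFz : DF (z r) (v, r^-1 *: b) = DF (z r) (v, 0) + r^-1 *: DF (z r) (0, b).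
  rewrite -blinZ -blinD; congr (DF (z r) _).
  by congr pair; rewrite /= ?scaler0 ?addr0 ?add0r.
have Thb : (T h : blin Z Y) (0, b) =
    (T ((z r).1 - r *: u, 0) : blin Z Y) (0, b) +
    r *: (T (u, 0) : blin Z Y) (0, b).
  by rewrite -[RHS]addr0 -(trivial_branch_second_derivative c h.2 b) Th.
(* As [DF (0, c) (0, b) = 0], [DF (z r)] may be replaced by [D] on [(0, b)]; then [r *: T (u, 0)] is
   traded for [T h] and the deviation of [z r] from [r *: u]. *)
have -> : DF (z r) (v, r^-1 *: b) -
      (DF (0, c) (v, 0) + (T (u, 0) : blin Z Y) (0, b)) =
    D (v, 0) + r^-1 *: ((D - T h : blin Z Y) (0, b) +
      (T ((z r).1 - r *: u, 0) : blin Z Y) (0, b)).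
  have -> : D (v, 0) = DF (z r) (v, 0) - DF (0, c) (v, 0) by [].
  have -> : (D - T h : blin Z Y) (0, b) =
    DF (z r) (0, b) - DF (0, c) (0, b) - (T h : blin Z Y) (0, b) by [].
  rewrite trivial_branch_derivative subr0 Thb DFz.
  have cancel (m t q : Y) : m - (t + q) + t = m - q.
    by rewrite opprD addrA addrAC subrK.
  rewrite cancel scalerBr scalerK ?gt_eqF//.
  by rewrite opprD -!addrA; congr (_ + _); rewrite addrCA.
have vle : `|v| <= `|(v, b)| by rewrite prod_normE le_max lexx.
have ble : `|b| <= `|(v, b)| by rewrite prod_normE le_max lexx orbT.
have nv : `|(v, 0 : 'rV[R]_n)| = `|v|.
  by rewrite prod_normE /= normr0; apply/max_idPl.
have nb : `|(0 : X, b)| = `|b|.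
  by rewrite prod_normE /= normr0; apply/max_idPr.
(* Each of the two directions receives one half of [d]. *)
rewrite (le_trans (ler_normD _ _))// [leRHS](_ : _ = d / 2 * `|(v, b)| +
  d / 2 * `|(v, b)|); last by field.
apply: lerD.
  rewrite (le_trans (blin_le _ _))// nv (@le_trans _ _ (d / 2 * `|v|))//.
    by rewrite ler_wpM2r.
  by rewrite ler_wpM2l// divr_ge0// ltW.
rewrite normrZ gtr0_norm ?invr_gt0// ler_pdivrMl//.
rewrite (le_trans (ler_normD _ _))// (@le_trans _ _
  (eta * (K * r) * `|b| + `|T| * (eta * r) * `|b|))//.
  apply: lerD.
    rewrite (le_trans (blin_le _ _))// nb ler_wpM2r// (le_trans hrem)//.
    by rewrite ler_wpM2l// ltW.
  rewrite (le_trans (blin_le2 _ _ _))// nb ler_wpM2r// ler_wpM2l//.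
  by rewrite prod_normE /= normr0 ge_max hu mulr_ge0// ltW.
rewrite (_ : _ + _ = r * (eta * (K + `|T|) * `|b|)); last by ring.
apply: ler_wpM2l; first exact: ltW.
apply: ler_pM => //; first by rewrite mulr_ge0 ?addr_ge0// ltW.
rewrite /eta mulrAC ler_pdivrMr ?mulr_gt0// ?ltr_wpDl ?addr_ge0//.
rewrite [leRHS](_ : _ = d * (K + `|T| + 1)); last by field.
by rewrite ler_wpM2l// ?lerDl// ltW.
Unshelve. all: by end_near. Qed.

End MixedDerivative.

(** * Asymptotics along a ray *)

Lemma enormZ (R : realType) n (r : R) (s : 'rV[R]_n) :
  enorm (r *: s) = `|r| * enorm s.
Proof.
rewrite /enorm (eq_bigr (fun i => r ^+ 2 * s 0 i ^+ 2)) => [|i _]; last first.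
  by rewrite mxE exprMn.
by rewrite -mulr_sumr sqrtrM ?sqr_ge0// sqrtr_sqr.
Qed.

Lemma cvg_ray (R : realType) n (s : 'rV[R]_n) :
  r *: s @[r --> 0^'+] --> (0 : 'rV[R]_n).
Proof.
rewrite -[X in _ --> X](scale0r s); apply: cvgZr_tmp.
exact: cvg_at_right_filter (@cvg_id _ _).
Qed.

Section Rays.
Context {R : realType} {n : nat} {V : normedModType R}.
Variables (s : 'rV[R]_n) (f : 'rV[R]_n -> V).
Hypothesis s1 : enorm s = 1.

(** Since [s] is a unit vector, [enorm (r *: s) = r] for [r > 0], which turns estimates at the
    origin into estimates in [r]. *)
Lemma near_ray (K : R) :
  (\forall x \near (0 : 'rV[R]_n), `|f x| <= K * `|enorm x : R^o|) ->
  \forall r \near 0^'+, `|f (r *: s)| <= K * r.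
Proof.
move=> fK.
have rK : \forall r \near 0^'+, `|f (r *: s)| <= K * `|enorm (r *: s)|.
  exact: (cvg_ray s) _ fK.
near=> r; have r0 : 0 < r by near: r; exact: nbhs_right_gt.
have : `|f (r *: s)| <= K * `|enorm (r *: s)| by near: r.
by rewrite enormZ s1 mulr1 normr_id gtr0_norm.
Unshelve. all: by end_near. Qed.

Lemma littleo_ray (eta : R) : f =o_ (0 : 'rV[R]_n) (enorm : 'rV[R]_n -> R^o) ->
  0 < eta -> \forall r \near 0^'+, `|f (r *: s)| <= eta * r.
Proof. by move=> /eqoP/(_ _)/[apply] /near_ray. Qed.

Lemma bigO_ray : f =O_ (0 : 'rV[R]_n) (enorm : 'rV[R]_n -> R^o) ->
  exists2 K : R, 0 < K & \forall r \near 0^'+, `|f (r *: s)| <= K * r.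
Proof. by move=> /eqO_exP[K K0 /near_ray fO]; exists K. Qed.

End Rays.

(** Index 0 makes the codimension of the range equal to the dimension of the kernel, so all [n]
    generators of the complement are required. *)
Lemma fredholm0_generators_neq0 (R : realType) (X Y : normedModType R) n
    (L : {linear X -> Y}) (y_ : 'I_n -> Y) (Yt : submodClosed Y) :
  fredholm_of_index 0 L -> has_dim n (kernel_of L) ->
  direct_decomposition (fun i => line (y_ i)) Yt -> [set` Yt] = range L ->
  forall i, y_ i != 0.
Proof.
move=> [_ _ [p [q [kp rq /esym/eqP pq]]]] kn yYt Ytr.
move: pq; rewrite subr_eq0 => /eqP[pq].
apply: (@decomposition_generators_neq0 _ _ _ _ _ yYt q); first by rewrite Ytr.
by rewrite -pq; exact: has_dim_unique_le kn kp.
Qed.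

(** * Restricted and rescaled operators as bounded maps *)

Section ScaledOperator.
Context {R : realType} {X Y : normedModType R} {n : nat}.
Local Notation Z := (X * 'rV[R]_n)%type.

Lemma restricted_linear (Xt : submodClosed X) (T : blin Z Y) :
  linear (fun u : subsp Xt * 'rV[R]_n => T (val u.1, u.2)).
Proof.
move=> a u v; by rewrite -blinZ -blinD; congr (T _).
Qed.

Lemma restricted_continuous (Xt : submodClosed X) (T : blin Z Y) :
  continuous (fun u : subsp Xt * 'rV[R]_n => T (val u.1, u.2)).
Proof.
apply: (@linear_fun_bounded_continuous _ _ _ _ `|T|) => [|u].
  exact: restricted_linear.
by rewrite (le_trans (blin_le _ _)).
Qed.

Definition restricted (Xt : submodClosed X) (T : blin Z Y) :
    blin (subsp Xt * 'rV[R]_n)%type Y :=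
  Blin (restricted_linear (Xt := Xt) T) (@restricted_continuous Xt T).

Lemma split_linear (T S : blin Z Y) :
  linear (fun u : Z => T (u.1, 0) + S (0, u.2)).
Proof.
move=> a u v; rewrite scalerDr addrACA -!blinZ -!blinD; congr (T _ + S _).
  by congr pair; rewrite /= scaler0 addr0.
by congr pair; rewrite /= scaler0 addr0.
Qed.

Lemma split_continuous (T S : blin Z Y) :
  continuous (fun u : Z => T (u.1, 0) + S (0, u.2)).
Proof.
apply: (@linear_fun_bounded_continuous _ _ _ _ (`|T| + `|S|)) => [|u].
  exact: split_linear.
rewrite (le_trans (ler_normD _ _))// mulrDl; apply: lerD.
  rewrite (le_trans (blin_le _ _))// ler_wpM2l// !prod_normE/= normr0.
  by rewrite ge_max !le_max lexx normr_ge0.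
rewrite (le_trans (blin_le _ _))// ler_wpM2l// !prod_normE/= normr0.
by rewrite ge_max !le_max lexx normr_ge0 orbT.
Qed.

(** With [T] the derivative at the bifurcation point and [S] the mixed derivative in direction [u],
    this is the limit operator before restriction to [Xt]. *)
Definition split_blin (T S : blin Z Y) : blin Z Y :=
  Blin (split_linear T S) (@split_continuous T S).

Lemma scaled_linear (T : blin Z Y) (r : R) :
  linear (fun u : Z => T (u.1, r *: u.2)).
Proof.
move=> a u v; rewrite -blinZ -blinD; congr (T _).
exact: scale_snd_linear.
Qed.

Lemma scaled_continuous (T : blin Z Y) (r : R) :
  continuous (fun u : Z => T (u.1, r *: u.2)).
Proof.
move=> u; apply: (@continuous_comp _ _ _ (fun u : Z => (u.1, r *: u.2)) T).
  exact: scale_snd_continuous.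
exact: blin_continuous.
Qed.

Definition scaled (T : blin Z Y) (r : R) : blin Z Y :=
  Blin (scaled_linear T r) (@scaled_continuous T r).

End ScaledOperator.

(** * Invertibility along the ray *)

Theorem propositionB3 (R : realType) (X Y : completeNormedModType R)
    (n : nat) (n_gt0 : (0 < n)%N)
    (k : smoothness) (k_ge2 : at_least_C2 k)
    (F : X * 'rV[R]_n -> Y) (cstar : 'rV[R]_n)
    (x_ : 'I_n -> X) (y_ : 'I_n -> Y)
    (Xt : submodClosed X) (Yt : submodClosed Y)
    (Q : 'I_n -> {linear X -> X}) (P : 'I_n -> {linear Y -> Y})
    (nu : 'M[R]_n)
    (F_smooth : smooth_on k setT F)
    (F_trivial : forall c, F (0, c) = 0)
    (L_fredholm : fredholm_of_index 0 (D1 F 0 cstar))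
    (L_ker : kernel_of (D1 F 0 cstar) =
             [set` sumsp predT (fun i => line (x_ i))])
    (L_ker_dim : has_dim n (kernel_of (D1 F 0 cstar)))
    (Xt_closed : closed [set` Xt]) (Yt_closed : closed [set` Yt])
    (X_decomposition : direct_decomposition (fun i => line (x_ i)) Xt)
    (Y_decomposition : direct_decomposition (fun i => line (y_ i)) Yt)
    (Yt_range : [set` Yt] = range (D1 F 0 cstar))
    (Q_projection : forall i,
      projection_onto_along (Q i) (line (x_ i)) (addsp (hatsp x_ i) Xt))
    (P_projection : forall i,
      projection_onto_along (P i) (line (y_ i)) (addsp (hatsp y_ i) Yt))
    (nu_def : forall i j (t : R),
      P i (D1Dc F j 0 cstar (x_ i) t) = (nu i j * t) *: y_ i)
    (nu_invertible : nu \in unitmx)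
    (invariance : forall i, exists (Xi : submodClosed X) (Yi : submodClosed Y),
      [/\ closed [set` Xi] /\ {subset Xi <= Xt},
          closed [set` Yi] /\ {subset Yi <= Yt},
          forall x c, x \in addsp (hatsp x_ i) Xi ->
            F (x, c) \in addsp (hatsp y_ i) Yi &
          exists T : {linear subsp (addsp (hatsp x_ i) Xi) ->
                             subsp (addsp (hatsp y_ i) Yi)},
            [/\ forall u, val (T u) =
                  D1 F 0 cstar (val u) - P i (D1 F 0 cstar (val u)),
                fredholm_of_index 0 T &
                kernel_of T = [set u | val u \in hatsp x_ i]]])
    (eps : R) (eps_gt0 : 0 < eps)
    (x : 'rV[R]_n -> X) (c : 'rV[R]_n -> 'rV[R]_n) (xt : 'rV[R]_n -> subsp Xt)
    (family_smooth : smooth_on (pred_smoothness k) [set s | enorm s < eps]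
      (fun s => (x s, c s)))
    (family_solves : forall s, enorm s < eps -> F (x s, c s) = 0)
    (family_x : forall s, enorm s < eps ->
      x s = \sum_i s 0 i *: x_ i + val (xt s))
    (family_xt : xt =o_ (0 : 'rV[R]_n) (enorm : 'rV[R]_n -> R^o))
    (family_c : (fun s => c s - cstar) =O_ (0 : 'rV[R]_n)
                  (enorm : 'rV[R]_n -> R^o))
    (shat : 'rV[R]_n) (shat_sphere : enorm shat = 1)
    (shat_neq0 : forall i, shat 0 i != 0) :
  exists2 r0 : R, 0 < r0 <= eps &
    forall r : R, 0 < r < r0 -> isomorphism (A F x_ xt c (r *: shat)).
Proof.
have [DF [D2F [dF d2F]]] := smooth_second_derivative k_ge2 F_smooth.
have y_neq0 := fredholm0_generators_neq0 L_fredholm L_ker_dim Y_decomposition Yt_range.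
pose u := \sum_l shat 0 l *: x_ l.
pose M b := (D2F (0, cstar) (u, 0) : blin _ _) (0, b).
(* Row [i] of [nu] is multiplied by [shat 0 i], the coefficient of [x_ i] in [u]. *)
pose N := diag_mx shat *m nu.
have N_unit : N \in unitmx.
  rewrite unitmx_mul nu_invertible andbT unitmxE det_diag unitfE.
  by apply/prodf_neq0 => i _; exact: shat_neq0.
(* By (B6), F maps the line through x_ l into a closed complement of the line
   through y_ i, hence so do the derivatives of F. *)
have PM_off i l b : l != i -> P i ((D2F (0, cstar) (x_ l, 0) : blin _ _) (0, b)) = 0.
  move=> li.
  have [Xi [Yi [_ [_ YiYt] FK _]]] := invariance i.
  have clK := projection_kernel_closed Yt_closed Y_decomposition (@P_projection i).
  have := @P_projection i 0 _ (rpred0 _)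
    (@mixed_derivative_mem _ _ _ _ _ _ _ dF d2F _ (x_ l) cstar b clK _).
  rewrite add0r; apply => a c'.
  have /asboolP[v [w [vY wY ->]]] : F (a *: x_ l, c') \in addsp (hatsp y_ i) Yi.
    apply: FK; apply/asboolP; exists (a *: x_ l), 0; rewrite addr0 rpred0.
    split => //; rewrite rpredZ//; apply/asboolP.
    exists (fun j => if j == l then x_ l else 0); split => [j _|].
      case: eqP => [->|_]; last exact: rpred0.
      by rewrite -[X in X \in _]scale1r mem_line.
    rewrite (bigD1 l) ?inE//= eqxx big1 ?addr0// => j /andP[_ /negPf ->].
    by [].
  by apply/asboolP; exists v, w; split => //; exact: YiYt.
(* Expanding [b] in the standard basis produces the entries of row [i] of [nu]. *)
have PM_diag i b : P i ((D2F (0, cstar) (x_ i, 0) : blin _ _) (0, b)) =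
    (nu *m b^T) i 0 *: y_ i.
  have -> : (0 : X, b) = \sum_j (0, b 0 j *: delta_mx 0 j).
    rewrite {1}[b]row_sum_delta.
    by elim/big_ind2 : _ => // [a1 a2 b1 b2 <- <-]; congr pair; rewrite /= addr0.
  rewrite blin_sum linear_sum mxE scaler_suml; apply: eq_bigr => j _.
  by rewrite -(D1DcE dF d2F) nu_def mxE.
have PM i b : P i (M b) = (N *m b^T) i 0 *: y_ i.
  have -> : M b = \sum_l shat 0 l *: (D2F (0, cstar) (x_ l, 0) : blin _ _) (0, b).
    rewrite /M.
    have -> : (u, 0 : 'rV[R]_n) = \sum_l shat 0 l *: (x_ l, 0 : 'rV[R]_n).
      rewrite /u; elim/big_ind2 : _ => // [a1 a2 b1 b2 <- <-|j _].
        by congr pair; rewrite /= addr0.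
      by congr pair; rewrite /= scaler0.
    rewrite blin_sum; elim/big_ind2 : _ => // [a1 a2 b1 b2 <- <-|j _] //.
    by rewrite blinZ.
  rewrite linear_sum (bigD1 i)//= big1 ?addr0 => [|l li]; last first.
    by rewrite linearZ /= PM_off// scaler0.
  rewrite linearZ /= PM_diag scalerA; congr (_ *: _).
  by rewrite /N -mulmxA mul_diag_mx [RHS]mxE.
pose B0 := restricted Xt (split_blin (DF (0, cstar)) (D2F (0, cstar) (u, 0))).
have B0E vb : B0 vb = D1 F 0 cstar (val vb.1) + M vb.2 by rewrite (D1E dF).
have sB0 e : exists vb, B0 vb = e.
  have [vb <-] := block_surjective L_ker Yt_range X_decomposition
    Y_decomposition P_projection N_unit PM e.
  by exists vb; rewrite B0E.
have iB0 vb : B0 vb = 0 -> vb = 0.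
  rewrite B0E; apply: (block_injective L_ker Yt_range X_decomposition
    P_projection y_neq0 N_unit PM).
  exact: blin0.
have cXt : seq_complete (subsp Xt * 'rV[R]_n)%type.
  by apply: prod_seq_complete; [exact: subsp_seq_complete|exact: rV_seq_complete].
have [C0 C0P] := surjective_bounded_preimage cXt sB0.
(* The added 1 makes [C] positive, so that [(2 * C)^-1] is an admissible tolerance [d] with [C * d]
   equal to one half. *)
pose C := `|C0| + 1.
have C_gt0 : 0 < C by rewrite ltr_wpDl.
have CP y : exists2 e, B0 e = y & `|e| <= C * `|y|.
  have [e eB eC] := C0P y; exists e => //; rewrite (le_trans eC)// ler_wpM2r//.
  by rewrite (le_trans (ler_norm _))// lerDl.
pose z r := (\sum_i (r *: shat) 0 i *: x_ i + val (xt (r *: shat)), c (r *: shat)).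
have [K K0 cK] := bigO_ray shat_sphere family_c.
have uE r : \sum_i (r *: shat) 0 i *: x_ i = r *: u.
  by rewrite scaler_sumr; apply: eq_bigr => i _; rewrite mxE scalerA.
have zu eta : 0 < eta -> \forall r \near 0^'+, `|(z r).1 - r *: u| <= eta * r.
  move=> /(littleo_ray shat_sphere family_xt); apply: filterS => r.
  by rewrite /z /= uE addrAC subrr add0r.
have zK : \forall r \near 0^'+, `|z r - (0, cstar)| <= (`|u| + 1 + K) * r.
  near=> r.
  have r0 : 0 < r by near: r; exact: nbhs_right_gt.
  have h1 : `|(z r).1 - r *: u| <= 1 * r by near: r; exact: zu.
  have h2 : `|c (r *: shat) - cstar| <= K * r by near: r.
  rewrite prod_normE /= ge_max subr0; apply/andP; split.
    rewrite -[X in `|X|](subrK (r *: u)) (le_trans (ler_normD _ _))//.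
    rewrite (@le_trans _ _ (1 * r + `|u| * r))//.
      by rewrite lerD// normrZ gtr0_norm// mulrC.
    rewrite -mulrDl; apply: ler_wpM2r; first exact: ltW.
    by rewrite [1 + _]addrC lerDl ltW.
  by rewrite (le_trans h2)// ler_wpM2r// ?lerDr// ltW.
have d0 : 0 < (2 * C)^-1 by rewrite invr_gt0 mulr_gt0.
have lim := rescaled_derivative_limit dF d2F F_trivial d0 zK zu.
have : \forall r \near 0^'+, isomorphism (A F x_ xt c (r *: shat)).
  near=> r.
  have r0 : 0 < r by near: r; exact: nbhs_right_gt.
  have isoS : isomorphism (restricted Xt (scaled (DF (z r)) r^-1)).
    apply: (perturbed_isomorphism (d := (2 * C)^-1) cXt _ (ltW C_gt0) CP iB0) => [|vb].
      by rewrite invfM mulrCA mulfV ?mulr1// gt_eqF.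
    have lr : forall v b, `|DF (z r) (v, r^-1 *: b) -
      (DF (0, cstar) (v, 0) + (D2F (0, cstar) (u, 0) : blin _ _) (0, b))| <=
      (2 * C)^-1 * `|(v, b)| by near: r.
    exact: lr (val vb.1) vb.2.
  (* The factors [r] and [r^-1] cancel, so [A] is the rescaled operator preceded by an
     isomorphism. *)
  rewrite (_ : A F x_ xt c (r *: shat) =
    restricted Xt (scaled (DF (z r)) r^-1) \o (fun vb => (vb.1, r *: vb.2))).
    by apply: isomorphism_comp isoS; apply: isomorphism_scale_snd; rewrite gt_eqF.
  apply/funext => vb; rewrite (AE dF).
  by rewrite -[X in DF _ (_, X)](scalerK (lt0r_neq0 r0)).
(* The minimum with [eps] keeps the points [r *: shat] in the ball where the solution family is
   given. *)
move=> [e /= e0 eP]; exists (Num.min e eps).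
  by rewrite lt_min e0 eps_gt0 ge_min lexx orbT.
move=> r /andP[r0]; rewrite lt_min => /andP[re _]; apply: eP => //=.
by rewrite sub0r normrN gtr0_norm.
Unshelve. all: by end_near. Qed.
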